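(* Let $g>1$ be an integer and let $f(X)\in\mathbb{Z}[X]$ be a polynomial of positive degree with positive leading coefficient and no multiple roots in its splitting field. Put $u(n)=f(g^n)$. For integers $M,N,s$ with $N\geq 1$ and $s$ square-free, let $Q_u(M,N;s)$ denote the number of integers $n\in[M+1,M+N]$ for which $\mathbb{Q}\left(\sqrt{u(n)}\right)=\mathbb{Q}\left(\sqrt{s}\right)$. Then $$Q_u(M,N;s)\ll N^{\frac{500}{679}}(\log N)^{\frac{358}{679}},$$ where the implied constant may depend on $f$ and $g$ but not on $M$, $N$, $s$.
   Context: The notation $A\ll B$ means $|A|\leq cB$ for some constant $c>0$.
   Formalization: The polynomials f(X)=aX are excluded, since for them the bound fails (Q(√u(n)) depends only on the parity of n), and log N is read as log max(N,2), since for N=1 the stated bound is 0 although the count can be 1. *)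

(* Defs.v *)
From HB Require Import structures.
From mathcomp Require Import all_boot all_order all_algebra all_field.
From mathcomp Require Import all_classical all_reals all_analysis.

Set Implicit Arguments.
Unset Strict Implicit.
Unset Printing Implicit Defensive.

Import Order.TTheory GRing.Theory Num.Theory.
Local Open Scope ring_scope.

(* Q(sqrt r), as the smallest subfield of algC (the algebraic closure of Q)
   containing sqrt r: every subfield contains Q.  Totality of inversion
   (0^-1 = 0) makes [divring_closed] exactly "is a subfield" here. *)
Definition Qsqrt (r : rat) : set algC :=
  [set z | forall K : {pred algC},
             divring_closed K -> sqrtC (ratr r) \in K -> z \in K]%classic.

Definition squarefree_int (s : int) : Prop :=
  forall d : int, (d ^+ 2 %| s)%Z -> `|d|%N = 1%N.

(* algC contains a splitting field of f. *)
Definition no_multiple_roots (f : {poly int}) : Prop :=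
  forall z : algC, (mup z (map_poly intr f) <= 1)%N.

(* The values are rational, and not only integral, because the exponent may
   be negative. *)
Definition u_seq (f : {poly int}) (g : int) (n : int) : rat :=
  (map_poly intr f).[(g%:~R : rat) ^ n].

(* Q_u(M,N;s); the integer n of [M+1,M+N] is written M + (i+1) with i < N. *)
Definition Qcount (f : {poly int}) (g : int) (M : int) (N : nat) (s : int)
  : nat :=
  #|[pred i : 'I_N | `[< Qsqrt (u_seq f g (M + i.+1%:Z)) = Qsqrt s%:~R >] ]|.

(* Main.v *)
Require Import Defs.
From HB Require Import structures.
From mathcomp Require Import all_boot all_order all_algebra all_field.
From mathcomp Require Import all_classical all_reals all_analysis.
From mathcomp Require Import zify ring lra.

(* If n and n + 2h both give the field Q(sqrt s), then f(x) f(k^2 x) is a square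
   for x = g^n and k = g^h.  As a polynomial in x over Z[k] it has even degree
   and square leading coefficient, so Runge's method applies: up to a square
   factor it is P^2 + R with deg R < deg P, and for large k the specialised R is
   nonzero because a simple nonzero root of f is not a root of f(k^2 x).  Hence
   x is at most a power of k, that is, n <= C h.  Negative n reduce to the
   reversed polynomial.  Such a gap principle leaves O(sqrt N) integers in a
   window of length N, and 1/2 < 500/679. *)

Set Implicit Arguments.
Unset Strict Implicit.
Unset Printing Implicit Defensive.

Import Order.TTheory GRing.Theory Num.Theory.
Local Open Scope ring_scope.

(** * Approximate square roots of polynomials *)

(** The square root is developed coefficient by coefficient from the top, [j] counting the
    corrections made. Each correction would divide by twice the leading coefficient of [P]; since
    [A] need not be a field, [m] collects these denominators. *)
Lemma poly_sqrt_remainder (A : idomainType) (F : {poly A}) (L : A) (d j : nat) :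
  2%:R != 0 :> A -> L != 0 -> (size F <= d.*2.+1)%N -> F`_d.*2 = L ^+ 2 ->
  (j <= d)%N ->
  exists m (P : {poly A}), [/\ m != 0, size P = d.+1 &
    (size (m ^+ 2 *: F - P ^+ 2)%R <= d.*2 - j)%N].
Proof.
move=> nz2 nzL szF FL; elim: j => [_|j IHj ltjd].
  exists 1, (L *: 'X^d); rewrite oner_eq0 size_scale // size_polyXn; split=> //.
  rewrite subn0 expr1n scale1r exprZn -exprM muln2; apply/leq_sizeP=> i.
  rewrite leq_eqVlt coefB coefZ coefXn => /predU1P[<-|lti].
    by rewrite FL eqxx mulr1 subrr.
  by rewrite gtn_eqF // mulr0 subr0 nth_default // (leq_trans szF).
have [m [P [nzm szP szR]]] := IHj (ltnW ltjd).
set R := m ^+ 2 *: F - P ^+ 2 in szR.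
pose e := (d - j.+1)%N; pose r := R`_(d.*2 - j.+1); pose l := P`_d.
have nzl : l != 0.
  by rewrite /l -[d]/(d.+1.-1) -szP -lead_coefE lead_coef_eq0
    -size_poly_eq0 szP.
have nz2l : 2%:R * l != 0 by rewrite mulf_neq0.
(* In the new remainder the cross term has coefficient [4 l^2 r] in degree [d + e = 2d - j - 1],
   which cancels [(2l)^2 r]; the term [r^2 X^(2e)] lies lower. *)
exists (2%:R * l * m), ((2%:R * l) *: P + r *: 'X^e); split.
- by rewrite mulf_neq0.
- rewrite size_polyDl !(size_scale _ nz2l) ?szP //.
  rewrite (leq_ltn_trans (size_scale_leq _ _)) // size_polyXn /e; lia.
have -> : (2%:R * l * m) ^+ 2 *: F - ((2%:R * l) *: P + r *: 'X^e) ^+ 2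
  = (2%:R * l) ^+ 2 *: R - (4%:R * l * r) *: (P * 'X^e) - r ^+ 2 *: 'X^(e + e).
  rewrite /R exprD -!mul_polyC !(rmorphM, rmorphXn, rmorphD, rmorph_nat) /=;
    ring.
apply/leq_sizeP=> i lei; rewrite !coefB !coefZ coefXn coefMXn.
have -> : (i == e + e)%N = false by rewrite /e; lia.
have -> : (i < e)%N = false by rewrite /e; lia.
rewrite mulr0 subr0; move: lei; rewrite leq_eqVlt => /predU1P[<-|lti].
  have -> : (d.*2 - j.+1 - e = d)%N by rewrite /e; lia.
  by rewrite -/r -/l; ring.
rewrite !nth_default ?mulr0 ?subr0 //; first by rewrite szP /e; lia.
by apply: leq_trans szR _; lia.
Qed.

(** * Size estimates and Runge's method over the integers *)

(** A geometric sum, kept free of division by the factor [x - 1]. *)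
Lemma horner_coef_bound (S : {poly int}) (B x : int) (n : nat) :
  (size S <= n)%N -> (forall i, `|S`_i| <= B) -> 1 <= x ->
  `|S.[x]| * (x - 1) <= B * (x ^+ n - 1).
Proof.
move=> szS leB x1; rewrite subrX1 mulrCA mulrC ler_wpM2l ?subr_ge0 //.
rewrite (horner_coef_wide _ szS) mulr_sumr (le_trans (ler_norm_sum _ _ _)) //.
apply: ler_sum => i _; rewrite normrM ler_pM // ger0_norm // exprn_ge0; lia.
Qed.

(** The leading coefficient is a nonzero integer, so the leading term has size at least [x ^+ n];
    the other terms fall under the previous bound. *)
Lemma horner_lead_bound (S : {poly int}) (B x : int) (n : nat) :
  size S = n.+1 -> (forall i, `|S`_i| <= B) -> 1 <= x ->
  x ^+ n * (x - 1) - B * (x ^+ n - 1) <= `|S.[x]| * (x - 1).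
Proof.
move=> szS leB x1.
have nzl : S`_n != 0.
  by rewrite -[n]/(n.+1.-1) -szS -lead_coefE lead_coef_eq0 -size_poly_eq0 szS.
pose T := take_poly n S.
have leT : `|T.[x]| * (x - 1) <= B * (x ^+ n - 1).
  apply: horner_coef_bound; rewrite ?size_take_poly // => i.
  by rewrite coef_take_poly; case: ifP => // _;
    rewrite normr0 (le_trans _ (leB 0)).
have -> : S.[x] = T.[x] + S`_n * x ^+ n.
  rewrite (@horner_coef_wide _ n.+1) ?szS // big_ord_recr /=; congr (_ + _).
  rewrite (@horner_coef_wide _ n) ?size_take_poly //; apply: eq_bigr => i _.
  by rewrite coef_take_poly ltn_ord.
have x0 : 0 <= x ^+ n by rewrite exprn_ge0; lia.
have : x ^+ n <= `|S`_n * x ^+ n|.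
  by rewrite normrM (ger0_norm x0) ler_peMl // -gtz0_ge1 normr_gt0.
have := lerB_normD (S`_n * x ^+ n) T.[x]; rewrite [_ + T.[x]]addrC.
have x10 : 0 <= x - 1 by rewrite subr_ge0.
by move=> /(ler_wpM2r x10) le1 /(ler_wpM2r x10) le2; lra.
Qed.

(** The squares next to [b^2] are at distance at least [2b - 1 >= b] from it. *)
Lemma sqr_addNsqr (w b a : int) :
  0 <= w -> 0 < `|a| -> `|a| < b -> w ^+ 2 <> b ^+ 2 + a.
Proof.
move=> w0 a0 ab; rewrite !expr2 => Ew.
have [lt|lt|eq] := ltgtP w b.
- have : w * w <= (b - 1) * (b - 1) by rewrite ler_pM; lia.
  lia.
- have : (b + 1) * (b + 1) <= w * w by rewrite ler_pM; lia.
  lia.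
- by rewrite eq in Ew; lia.
Qed.

(* Otherwise [z^2 = P(x)^2 + R(x)] with [0 < |R(x)| < |P(x)|], too close to
   [P(x)^2] to be another square. *)
Lemma runge_bound (P R : {poly int}) (B x z : int) :
  R != 0 -> (size R < size P)%N ->
  (forall i, `|P`_i| <= B) -> (forall i, `|R`_i| <= B) ->
  z ^+ 2 = (P ^+ 2 + R).[x] -> x <= 2 * B + 1.
Proof.
move=> nzR ltRP leP leR; rewrite hornerD horner_exp => Ez.
rewrite leNgt; apply/negP=> ltx.
have B0 : 0 <= B by apply: le_trans (leP 0); rewrite normr_ge0.
have x1 : 1 <= x by lia.
have [r szR] : exists r, size R = r.+1.
  by exists (size R).-1; rewrite prednK // size_poly_gt0.
have [n szP] : exists n, size P = n.+1.
  by exists (size P).-1; rewrite prednK // (leq_ltn_trans _ ltRP).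
have x10 : 0 < x - 1 by lia.
(* Since [x - 1 >= 2B + 1], a leading term outweighs two lower tails at once. This margin yields
   both [R(x) != 0] and [|R(x)| < |P(x)|]. *)
have big k : 2 * (B * x ^+ k) + x ^+ k <= x ^+ k * (x - 1) /\ 0 <= B * x ^+ k.
  have xk : 0 <= x ^+ k by rewrite exprn_ge0 // ltW.
  split; last exact: mulr_ge0.
  have -> : 2 * (B * x ^+ k) + x ^+ k = x ^+ k * (2 * B + 1) by ring.
  by rewrite ler_wpM2l //; clear -ltx; lia.
have R0 : 0 < `|R.[x]|.
  rewrite -(pmulr_lgt0 _ x10) (lt_le_trans _ (horner_lead_bound szR leR x1)) //.
  have Xr : 1 <= x ^+ r by rewrite exprn_ege1.
  have [] := big r; rewrite mulrBr mulr1; clear -Xr B0; lia.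
have RP : `|R.[x]| < `|P.[x]|.
  rewrite -(ltr_pM2r x10).
  have szRn : (size R <= n)%N by rewrite -ltnS -szP.
  rewrite (le_lt_trans (horner_coef_bound szRn leR x1)) //.
  rewrite (lt_le_trans _ (horner_lead_bound szP leP x1)) //.
  have Xn : 1 <= x ^+ n by rewrite exprn_ege1.
  have [] := big n; rewrite mulrBr mulr1; clear -Xn B0; lia.
apply: (@sqr_addNsqr `|z| `|P.[x]| R.[x]) => //.
by rewrite !real_normK ?num_real.
Qed.

(** * Growth and nonvanishing in the parameter [k] *)

(** One [C] is both factor and exponent, so that several bounds merge by taking a maximum. *)
Lemma poly_growth (c : {poly int}) :
  exists C : nat, forall k : nat, (0 < k)%N -> `|c.[k%:Z]| <= C%:Z * k%:Z ^+ C.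
Proof.
elim/poly_ind: c => [|c a [C leC]].
  by exists 0%N => k _; rewrite horner0 normr0.
exists (C + `|a|).+1%N => k k0; rewrite hornerMXaddC.
have := leC k k0.
have : k%:Z ^+ C <= k%:Z ^+ (C + `|a|) by rewrite ler_weXn2l; lia.
have : 1 <= k%:Z ^+ (C + `|a|) by rewrite exprn_ege1; lia.
rewrite exprS; move: (k%:Z ^+ C) (k%:Z ^+ _) (c.[k%:Z]) => X Y b Y1 XY leb.
have k1 : 1 <= k%:Z by lia.
have leb' : `|b| * k%:Z <= C%:Z * (k%:Z * Y).
  by rewrite mulrC mulrCA ler_wpM2l // (le_trans leb) // ler_wpM2l.
have Z1 : 1 <= k%:Z * Y by rewrite -[1]mulr1 ler_pM.
have lea : `|a| <= `|a| * (k%:Z * Y) by rewrite ler_peMr.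
rewrite (le_trans (ler_normD _ _)) // normrM (ger0_norm (le0z_nat k)).
rewrite -addn1 !PoszD abszE !mulrDl mul1r; clear -leb' lea Z1; lia.
Qed.

Lemma coef_growth (P : {poly {poly int}}) :
  exists C : nat, forall (k i : nat), (0 < k)%N ->
    `|(P`_i).[k%:Z]| <= C%:Z * k%:Z ^+ C.
Proof.
have mono (C D k : nat) : (0 < k)%N -> (C <= D)%N ->
    C%:Z * k%:Z ^+ C <= D%:Z * k%:Z ^+ D.
  by move=> k0 CD; rewrite ler_pM // ?exprn_ge0 // ?ler_weXn2l //; lia.
elim/poly_ind: P => [|P c [C leC]].
  by exists 0%N => k i _; rewrite coef0 horner0 normr0.
have [D leD] := poly_growth c.
exists (maxn C D) => k i k0; rewrite coefD coefMX coefC.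
case: i => [|i] /=.
  by rewrite add0r (le_trans (leD k k0)) // mono // leq_maxr.
by rewrite addr0 (le_trans (leC k i k0)) // mono // leq_maxl.
Qed.

Lemma eventually_nonroot (q : {poly algC}) : q != 0 ->
  exists k0 : nat, forall k : nat, (k0 <= k)%N -> q.[k%:R] != 0.
Proof.
move=> nzq; have [rs Eq] := closed_field_poly_normal q.
have [k0 Hk0] : exists k0 : nat, forall k : nat, (k0 <= k)%N -> k%:R \notin rs.
  elim: rs {Eq} => [|r rs [k0 Hk0]]; first by exists 0%N.
  exists (maxn k0 (Num.bound `|r|)) => k; rewrite geq_max => /andP[le1 le2].
  rewrite inE negb_or Hk0 // andbT; apply: contraTneq le2 => Er.
  rewrite -ltnNge -(ltr_nat algC) Er -{1}(@ger0_norm algC r) ?archi_boundP //.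
  by rewrite -Er.
exists k0 => k /Hk0 nk; rewrite Eq hornerZ mulf_neq0 ?lead_coef_eq0 //.
by rewrite -/(root _ _) root_prod_XsubC.
Qed.

Lemma PoszX (a n : nat) : (a ^ n)%N%:Z = a%:Z ^+ n.
Proof. by rewrite -!natz natrX. Qed.

(** * The gap principle at a simple nonzero root *)

(** Runge's method is carried out once over [Z[k]], with [k] an indeterminate, and only then
    specialised to [k = g^h]; hence the constants do not depend on [h]. *)
Lemma simple_root_gap (p : {poly int}) (a : algC) (g : nat) :
  (1 < g)%N -> a != 0 -> root (map_poly intr p) a ->
  ~~ root (map_poly intr p)^`() a ->
  exists h0 C : nat, forall (n h : nat) (y : int), (h0 <= h)%N -> (0 < h)%N ->
    p.[g%:Z ^+ n] * p.[g%:Z ^+ (n + h.*2)] = y ^+ 2 -> (n <= C * h)%N.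
Proof.
move=> g1 nza pa p'a.
have nzp : p != 0 by apply: contraNneq p'a => ->; rewrite rmorph0 deriv0 root0.
pose d := (size p).-1; pose PP := map_poly (@polyC int) p.
have szp : size p = d.+1 by rewrite prednK // size_poly_gt0.
(* The inner variable of [{poly int}] stands for [k], so this is [p(X) p(k^2 X)]. *)
pose F := PP * (PP \Po (('X^2 : {poly int}) *: 'X)).
have nzX : ('X^2 : {poly int}) != 0 by rewrite monic_neq0 ?monicXn.
have szX : size (('X^2 : {poly int}) *: 'X) = 2
  by rewrite size_scale ?size_polyX.
have nzPP : PP != 0 by rewrite map_polyC_eq0.
have szPP : size PP = d.+1 by rewrite size_map_polyC.
have nzPX : PP \Po (('X^2 : {poly int}) *: 'X) != 0.
  by rewrite comp_poly_eq0 ?szX.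
have szF : size F = d.*2.+1.
  by rewrite size_mul // size_comp_poly2 // szPP addSn addnS -addnn.
pose L : {poly int} := (lead_coef p)%:P * 'X^d.
have FL : F`_d.*2 = L ^+ 2.
  rewrite -[d.*2]/(d.*2.+1.-1) -szF -lead_coefE lead_coefM
    lead_coef_comp ?szX //.
  rewrite lead_coefZ lead_coefX mulr1 szPP /=.
  rewrite lead_coef_map_eq ?polyC_eq0 ?lead_coef_eq0 //.
  by rewrite ['X^2 ^+ d]exprMn [RHS]expr2 [RHS]mulrACA -[RHS]mulrA.
have nzL : L != 0.
  by rewrite mulf_neq0 ?(monic_neq0 (monicXn _ _)) ?polyC_eq0 ?lead_coef_eq0.
have nz2 : 2%:R != 0 :> {poly int} by rewrite -polyC_natr polyC_eq0.
have szF' : (size F <= d.*2.+1)%N by rewrite szF.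
have [m [P [nzm szP szR]]] :=
   poly_sqrt_remainder nz2 nzL szF' FL (leqnn d).
set R := m ^+ 2 *: F - P ^+ 2 in szR.
have {szR} szR : (size R <= d)%N by rewrite (leq_trans szR) // -addnn addnK.
have [C1 leP] := coef_growth P; have [C2 leR] := coef_growth R.
have nzl : P`_d != 0.
  by rewrite -[d]/(d.+1.-1) -szP -lead_coefE lead_coef_eq0 -size_poly_eq0 szP.
have intr_inj0 (q : {poly int}) : q != 0 -> map_poly intr q != 0 :> {poly algC}.
  move=> nzq; rewrite -size_poly_eq0 size_map_inj_poly ?size_poly_eq0 //.
  exact: intr_inj.
have evint (q : {poly int}) (k : nat) :
    (map_poly intr q : {poly algC}).[k%:R] = (q.[k%:Z])%:~R.
  by rewrite -horner_map.
(* Three values must not vanish at [k]: [m], to keep the identity nontrivial; the leading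
   coefficient of [P], to keep its degree; and [p(k^2 a)], to keep [a] a simple zero of
   [p(X) p(k^2 X)]. *)
have [k1 Hk1] := eventually_nonroot (intr_inj0 _ nzm).
have [k2 Hk2] := eventually_nonroot (intr_inj0 _ nzl).
have nzq : (map_poly intr p) \Po (a *: 'X^2) != 0.
  by rewrite comp_poly_eq0 ?intr_inj0 // size_scale // size_polyXn.
have [k3 Hk3] := eventually_nonroot nzq.
pose C := maxn C1 C2.
(* As [h <= g^h], thresholds for [k] also serve for [h]. The bound [g^n <= 2 C k^C + 1] will give
   [n <= 2C + 1 + hC], which is at most [(3C + 1) h] because [h >= 1]. *)
exists (maxn k1 (maxn k2 k3)), (3 * C + 1)%N => n h y.
rewrite !geq_max => /and3P[h1 h2 h3] h0 Ey.
pose k := (g ^ h)%N.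
have hk : (h <= k)%N by rewrite ltnW // ltn_expl.
have k0 : (0 < k)%N by rewrite expn_gt0 ltnW.
have {}Hk1 := Hk1 k (leq_trans h1 hk); have {}Hk2 := Hk2 k (leq_trans h2 hk).
have {}Hk3 := Hk3 k (leq_trans h3 hk).
rewrite evint intr_eq0 in Hk1; rewrite evint intr_eq0 in Hk2.
rewrite horner_comp hornerZ hornerXn in Hk3.
pose ev (Q : {poly {poly int}}) : {poly int} := map_poly (horner_eval k%:Z) Q.
have evE Q i : (ev Q)`_i = (Q`_i).[k%:Z] by rewrite coef_map.
have evPP : ev PP = p by apply/polyP=> i; rewrite evE coef_map hornerC.
have evF : ev F = p * (p \Po (k%:Z ^+ 2 *: 'X)).
  rewrite /F /ev rmorphM /= -/(ev _) evPP map_comp_poly -/(ev PP) evPP.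
  by rewrite map_polyZ map_polyX /= /horner_eval hornerXn.
have evR : ev P ^+ 2 + ev R = m.[k%:Z] ^+ 2 *: ev F.
  rewrite /ev -rmorphXn -rmorphD /= addrC subrK map_polyZ /= /horner_eval.
  by rewrite horner_exp.
have szevP : size (ev P) = d.+1.
  apply/eqP; rewrite eqn_leq -{1}szP size_poly ltnNge.
  by apply: contra Hk2 => /leq_sizeP/(_ d (leqnn d)); rewrite evE => ->.
have szevR : (size (ev R) <= d)%N by rewrite (leq_trans (size_poly _ _)).
(* Otherwise the double zero of [P^2] at [a] would be a simple zero of
   [p(X) p(k^2 X)]. *)
have nzevR : ev R != 0.
  apply: contraNneq p'a => R0; move: evR; rewrite R0 addr0 evF.
  move/(congr1 (map_poly (intr : int -> algC))).
  rewrite rmorphXn /= map_polyZ [map_poly _ (p * _)]rmorphM /= map_comp_poly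
    map_polyZ map_polyX /=.
  set pC := map_poly intr p; set PC := map_poly intr (ev P).
  set mk : algC := (_ ^+ 2)%:~R; set kk : algC := (_ ^+ 2)%:~R => E.
  have nzmk : mk != 0 by rewrite /mk intr_eq0 expf_neq0.
  have nzpk : (pC \Po (kk *: 'X)).[a] != 0.
    rewrite horner_comp hornerZ hornerX /kk rmorphXn /=.
    by move: Hk3; rewrite mulrC.
  have /eqP Pa : PC.[a] == 0.
    by rewrite -sqrf_eq0 -horner_exp E hornerZ hornerM (rootP pa) mul0r mulr0.
  move/(congr1 (fun q : {poly algC} => q^`().[a])): E.
  rewrite deriv_exp derivZ derivM /=
    !(hornerMn, hornerM, hornerD, hornerZ) expr1.
  rewrite Pa mulr0 mul0rn (rootP pa) mul0r addr0 => /esym/eqP.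
  by rewrite mulf_eq0 (negPf nzmk) mulf_eq0 (negPf nzpk) orbF.
have mono (D : nat) : (D <= C)%N -> D%:Z * k%:Z ^+ D <= C%:Z * k%:Z ^+ C.
  by move=> DC; rewrite ler_pM ?exprn_ge0 ?ler_weXn2l.
have : g%:Z ^+ n <= 2 * (C%:Z * k%:Z ^+ C) + 1.
  (* With [x = g^n] one has [k^2 x = g^(n + 2h)], so [m(k)^2 p(x) p(k^2 x)] is the square of
     [m(k) y]. *)
  apply: (@runge_bound (ev P) (ev R) _ _ (m.[k%:Z] * y)) => //.
  - by rewrite szevP.
  - by move=> i; rewrite evE (le_trans (leP _ _ k0)) // mono // leq_maxl.
  - by move=> i; rewrite evE (le_trans (leR _ _ k0)) // mono // leq_maxr.
  rewrite evR evF exprMn -Ey hornerZ hornerM horner_comp hornerZ hornerX.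
  by rewrite /k PoszX -exprM muln2 exprD [g%:Z ^+ n * _]mulrC.
rewrite -!PoszX => leg.
have {}leg : (g ^ n <= (2 * C + 1) * g ^ (h * C))%N.
  have kC : (0 < k ^ C)%N by rewrite expn_gt0 k0.
  by rewrite expnM -/k; move: kC leg; clear; lia.
have : (g ^ n < g ^ (2 * C + 1 + h * C))%N.
  apply: (leq_ltn_trans leg); rewrite expnD ltn_pmul2r.
    exact: ltn_expl.
  by rewrite expn_gt0 ltnW.
rewrite ltn_exp2l // => /ltnW le_n; apply: (leq_trans le_n).
by move: (C) h0 => D; clear; nia.
Qed.

(** * Reversed polynomials and simple roots *)

(** The reciprocal polynomial [X^d p(1/X)] with [d = deg p]; it turns values at [g^(-n)] into values
    at [g^n]. *)
Definition revp (A : nzRingType) (p : {poly A}) : {poly A} :=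
  \poly_(i < size p) p`_((size p).-1 - i).

Lemma map_revp (A B : nzRingType) (h : {additive A -> B}) (p : {poly A}) :
  injective h -> map_poly h (revp p) = revp (map_poly h p).
Proof.
move=> hI; apply/polyP=> i; rewrite coef_map [in LHS]coef_poly
  [RHS]coef_poly size_map_inj_poly ?raddf0 //.
by case: ifP; rewrite ?raddf0 // coef_map.
Qed.

Lemma horner_revp (F : fieldType) (p : {poly F}) (x : F) : x != 0 ->
  (revp p).[x] = x ^+ (size p).-1 * p.[x^-1].
Proof.
move=> nzx; rewrite horner_poly horner_coef.
rewrite (reindex_inj rev_ord_inj) mulr_sumr; apply: eq_bigr => i _ /=.
have lei : (i <= (size p).-1)%N by rewrite -ltnS (ltn_predK (ltn_ord i)).
have -> : (size p - i.+1 = (size p).-1 - i)%N by rewrite -subn1 -subnDA.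
rewrite subKn // [RHS]mulrCA; congr (_ * _).
by rewrite -[in RHS](subnK lei) exprD exprVn mulfK ?expf_neq0.
Qed.

(** The derivative of [(X - a) q] takes the value [q(a)] at [a]. The factored form passes to the
    reversed polynomial more easily than a condition on the derivative. *)
Lemma simple_rootP (F : fieldType) (p : {poly F}) (a : F) :
  reflect (exists2 q, p = ('X - a%:P) * q & ~~ root q a)
          (root p a && ~~ root p^`() a).
Proof.
have dE (q : {poly F}) : root (('X - a%:P) * q)^`() a = root q a.
  rewrite /root derivM derivXsubC mul1r hornerD hornerM hornerXsubC subrr.
  by rewrite mul0r addr0.
apply: (iffP andP) => [[/factor_theorem[q ->]]|[q -> nq]].
  by rewrite mulrC dE; exists q; rewrite // mulrC.
by rewrite dE rootM root_XsubC eqxx.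
Qed.

(** Reversing [(X - a) q] gives [(1 - a X) rev q = (X - 1/a) (- a rev q)], and [rev q] at [1/a] is
    [q(a)] up to a power of [a]. *)
Lemma simple_root_revp (p : {poly algC}) (a : algC) :
  a != 0 -> root p a -> ~~ root p^`() a ->
  root (revp p) a^-1 /\ ~~ root (revp p)^`() a^-1.
Proof.
move=> nza pa p'a.
have /simple_rootP[q Ep qa] : root p a && ~~ root p^`() a by rewrite pa.
have nzq : q != 0 by apply: contraNneq qa => ->; rewrite root0.
have szp : (size p).-1 = (size q).-1.+1.
  by rewrite Ep size_monicM ?monicXsubC // size_XsubC /=
    prednK // size_poly_gt0.
have Erev : revp p = ('X - (a^-1)%:P) * (- a *: revp q).
  (* If the two sides were distinct, they would differ at some positive integer [k0 + 1]; there
     [horner_revp] applies and shows them equal. *)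
  apply/eqP; rewrite -subr_eq0; apply/negPn/negP=> /eventually_nonroot[k0].
  move=> /(_ k0.+1 (leqnSn _)) /eqP[].
  have nzk : k0.+1%:R != 0 :> algC by rewrite pnatr_eq0.
  rewrite hornerD hornerN hornerM hornerXsubC hornerZ !horner_revp //.
  rewrite szp Ep hornerM hornerXsubC exprS.
  move: (k0.+1%:R) nzk => k nzk.
  by field; rewrite nza nzk.
apply/andP/simple_rootP; exists (- a *: revp q) => //.
rewrite /root hornerZ horner_revp ?invr_eq0 // invrK !mulf_neq0 ?oppr_eq0 //.
by rewrite expf_neq0 ?invr_eq0.
Qed.

(** All roots are simple. If 0 were the only one, [f] would be [a *: 'X], for which no gap principle
    can hold: the product of [a g^n] and [a g^(n + 2h)] is always a square. *)
Lemma exists_simple_root (f : {poly int}) :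
  (1 < size f)%N -> no_multiple_roots f -> (forall a : int, f <> a *: 'X) ->
  exists a : algC, [/\ a != 0, root (map_poly intr f) a &
    ~~ root (map_poly intr f)^`() a].
Proof.
move=> szf sep nmono; set p : {poly algC} := map_poly intr f.
have szp : size p = size f by rewrite size_map_inj_poly //; apply: intr_inj.
have nzp : p != 0 by rewrite -size_poly_gt0 szp ltnW.
have [rs Ep] := closed_field_poly_normal p.
have nzl : lead_coef p != 0 by rewrite lead_coef_eq0.
have rootE z : root p z = (z \in rs) by rewrite Ep rootZ // root_prod_XsubC.
have mup1 z : ~~ (('X - z%:P) ^+ 2 %| p) by rewrite -mup_ltn // ltnS sep.
have [/allP rs0|/allPn[a rsa nza]] := boolP (all (pred1 0) rs); last first.
  exists a; split=> //; first by rewrite rootE.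
  have : root p a by rewrite rootE.
  case/factor_theorem=> q Eq; have := mup1 a; rewrite Eq expr2.
  rewrite dvdp_mul2r ?polyXsubC_eq0 //.
  rewrite dvdp_XsubCl derivM derivXsubC mulr1 => nqa.
  by rewrite /root hornerD hornerM hornerXsubC subrr mulr0 add0r.
have {rootE} Ers : rs = nseq (size rs) 0.
  by apply/all_pred1P; apply/allP.
move: Ep; rewrite Ers big_nseq iter_mulr_1 => Ep.
have szrs : size rs = (size f).-1.
  by rewrite -szp Ep size_scale // size_exp_XsubC.
have /(congr1 predn) := szrs.
case Es : (size rs) => [|[|n]] /= _.
- by move: szrs szf; rewrite Es; case: (size f) => [|[|]].
- have [] := nmono (lead_coef f);
  apply: (map_inj_poly (f := (intr : int -> algC))) => //.
    exact: intr_inj.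
  rewrite -/p Ep Es expr1 subr0 map_polyZ map_polyX.
  by rewrite lead_coef_map_inj //; apply: intr_inj.
- by have := mup1 0; rewrite Ep Es dvdpZr // dvdp_exp2l.
Qed.

(** * Rational squares and quadratic fields *)

(** Equality of fields yields squares of rationals, while Runge's method needs squares of
    integers. *)
Lemma rat_sqr_int (a : int) (y : rat) :
  a%:~R = y ^+ 2 -> exists b : int, a = b ^+ 2.
Proof.
move=> Ey; have nzd : (denq y)%:~R != 0 :> rat by rewrite intr_eq0 denq_neq0.
have E : a * denq y ^+ 2 = numq y ^+ 2.
  apply: (intr_inj (R := rat)); rewrite rmorphM !rmorphXn /= numqE Ey.
  by rewrite exprMn.
have dvd : (`|denq y| %| `|numq y|)%N.
  by rewrite -(@dvdn_pexp2r _ _ 2) // -!abszX -E abszM dvdn_mull.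
have d1 : denq y = 1.
  have := coprime_num_den y.
  rewrite coprime_sym /coprime (gcdn_idPl dvd) => /eqP d1.
  by have := denq_gt0 y; lia.
by exists (numq y); rewrite -E d1 expr1n mulr1.
Qed.

(** The elements [a + b w] already form a subfield containing [w]. *)
Lemma Qsqrt_coords (r : rat) (z : algC) : Qsqrt r z ->
  exists a b : rat, z = ratr a + ratr b * sqrtC (ratr r).
Proof.
set w := sqrtC _; have w2 : w ^+ 2 = ratr r by rewrite sqrtCK.
pose K := [pred x : algC | `[< exists a b : rat, x = ratr a + ratr b * w >]].
move=> /(_ K) zK; apply/asboolP; apply: zK; last first.
  by apply/asboolP; exists 0, 1; rewrite rmorph0 rmorph1 add0r mul1r.
have inv x : x \in K -> x^-1 \in K.
  move=> /asboolP[a [b Ex]]; apply/asboolP.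
  have [->|nzx] := eqVneq x 0.
    by exists 0, 0; rewrite invr0 rmorph0 mul0r addr0.
  (* The conjugate of a nonzero [x] can vanish when [w] is rational; then [x = 2a]. *)
  have [Eab|nzab] := eqVneq (ratr a - ratr b * w) 0.
    exists (a *+ 2)^-1, 0;
      rewrite rmorph0 mul0r addr0 fmorphV rmorphMn /= mulr2n.
    by rewrite Ex; congr (_^-1); congr (_ + _);
      apply/esym/eqP; rewrite -subr_eq0 Eab.
  exists (a / (a ^+ 2 - b ^+ 2 * r)), (- b / (a ^+ 2 - b ^+ 2 * r)).
  rewrite !(rmorphM, rmorphN, fmorphV, rmorphB, rmorphXn) /= -w2.
  have -> : ratr a ^+ 2 - ratr b ^+ 2 * w ^+ 2 = x * (ratr a - ratr b * w).
    by rewrite Ex; ring.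
  by field; rewrite nzx nzab.
split.
- by apply/asboolP; exists 1, 0; rewrite rmorph1 rmorph0 mul0r addr0.
- move=> _ _ /asboolP[a [b ->]] /asboolP[c [e ->]]; apply/asboolP.
  by exists (a - c), (b - e); rewrite !rmorphB /=; ring.
- move=> x y xK /inv; move: (y^-1) xK => {}y.
  move=> /asboolP[a [b ->]] /asboolP[c [e ->]]; apply/asboolP.
  exists (a * c + b * e * r), (a * e + b * c).
  by rewrite !(rmorphM, rmorphD) /= -w2; ring.
Qed.

(** Write [sqrt r = a + b sqrt t]. If [b = 0], both square roots are rational; if [a = 0], then
    [r t = (b t)^2]; otherwise squaring expresses [sqrt t] rationally, and again both are
    rational. *)
Lemma Qsqrt_eq_mul_sqr (r t : rat) :
  Qsqrt r = Qsqrt t -> exists y, r * t = y ^+ 2.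
Proof.
move=> Ert; have sq (q : rat) : Qsqrt q (sqrtC (ratr q)) by move=> K _.
have := sq r; rewrite Ert => /Qsqrt_coords[a [b Er]].
have := sq t; rewrite -Ert => /Qsqrt_coords[c [e Et]].
have injR := fmorph_inj (ratr : {rmorphism rat -> algC}).
have rational (x y : rat) : sqrtC (ratr r) = ratr x :> algC ->
    sqrtC (ratr t) = ratr y :> algC -> exists y, r * t = y ^+ 2.
  move=> Ex Ey; exists (x * y); apply: injR.
  by rewrite rmorphXn !rmorphM /= exprMn -Ex -Ey !sqrtCK.
move: Er Et rational; set w := sqrtC (ratr r); set v := sqrtC (ratr t).
move=> Er Et rational.
have w2 : w ^+ 2 = ratr r by rewrite sqrtCK.
have v2 : v ^+ 2 = ratr t by rewrite sqrtCK.
have [b0|nzb] := eqVneq b 0.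
  have Ew : w = ratr a by rewrite Er b0 rmorph0 mul0r addr0.
  by apply: (rational a (c + e * a)); rewrite // Et Ew rmorphD rmorphM.
have [a0|nza] := eqVneq a 0.
  exists (b * t); apply: injR;
    rewrite rmorphXn !rmorphM /= -w2 -v2 Er a0 rmorph0.
  by ring.
pose x := (r - a ^+ 2 - b ^+ 2 * t) / (2%:R * a * b).
have Ev : v = ratr x.
  rewrite /x !(rmorphM, rmorphB, fmorphV, rmorphXn, rmorph_nat) /= -w2 -v2 Er.
  by field; rewrite !fmorph_eq0 nza nzb.
by apply: (rational (a + b * x) x) => //; rewrite Er Ev rmorphD rmorphM.
Qed.

(** * The gap principle for all integer exponents, and the count it allows *)

Lemma u_seq_gap (f : {poly int}) (g : int) :
  1 < g -> (1 < size f)%N -> no_multiple_roots f ->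
  (forall a : int, f <> a *: 'X) ->
  exists h0 C : nat, (0 < h0)%N /\ forall (n n' : int) (h : nat) (y : rat),
    (0 <= n) = (0 <= n') -> `|n'|%N = (`|n| + h.*2)%N -> (h0 <= h)%N ->
    u_seq f g n * u_seq f g n' = y ^+ 2 -> (`|n| <= C * h)%N.
Proof.
move=> hg szf sep nmono.
have [a [nza fa f'a]] := exists_simple_root szf sep nmono.
case: g hg => // g hg; have {}hg : (1 < g)%N by lia.
have injQ : injective (intr : int -> rat) by exact: intr_inj.
have [ra r'a] := simple_root_revp nza fa f'a.
rewrite -map_revp in ra r'a; last exact: intr_inj.
have [h1 [C1 gap1]] := simple_root_gap hg nza fa f'a.
have nza' : a^-1 != 0 by rewrite invr_eq0.
have [h2 [C2 gap2]] := simple_root_gap hg nza' ra r'a.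
have evQ (p : {poly int}) (n : nat) :
    (map_poly intr p : {poly rat}).[g%:~R ^+ n] = (p.[g%:Z ^+ n])%:~R.
  by rewrite -horner_map rmorphXn.
exists (maxn 1 (maxn h1 h2)), (maxn C1 C2); split; first by rewrite leq_max.
move=> n n' h y sgn Eabs; rewrite !geq_max => /and3P[h0 le1 le2].
have [n0|n0] := leP 0 n.
  case: n n0 sgn Eabs => // n _; case: n' => // n' _ /= -> Ey.
  have [b Eb] : exists b : int, f.[g%:Z ^+ n] * f.[g%:Z ^+ (n + h.*2)] = b ^+ 2.
    by apply: (@rat_sqr_int _ y); rewrite -Ey rmorphM /= -!evQ.
  by rewrite (leq_trans (gap1 _ _ _ le1 h0 Eb)) // leq_mul2r leq_maxl orbT.
move: sgn; rewrite leNgt n0 /= => /esym/negbT; rewrite -ltNge => n'0.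
have uN (m : int) : m < 0 -> u_seq f g m =
    (g%:~R ^+ (`|m| * (size f).-1))^-1 * ((revp f).[g%:Z ^+ `|m|])%:~R.
  move=> m0; have Em : m = - (`|m|%N)%:Z by rewrite abszE ltr0_norm // opprK.
  rewrite /u_seq {1}Em -exprnN -evQ map_revp // horner_revp; last first.
    by rewrite expf_neq0 // intr_eq0; lia.
  rewrite size_map_inj_poly // -exprM mulKf //.
  by rewrite expf_neq0 // intr_eq0; lia.
rewrite !uN // Eabs; move: (`|n|%N) ((size f).-1) => k d Ey.
have [b Eb] : exists b : int,
    (revp f).[g%:Z ^+ k] * (revp f).[g%:Z ^+ (k + h.*2)] = b ^+ 2.
  (* The exponent [(k + h) d] is half of [k d + (k + 2h) d]. *)
  apply: (@rat_sqr_int _ (y * g%:~R ^+ ((k + h) * d))).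
  have gX m : (g%:~R : rat) ^+ m != 0 by rewrite expf_neq0 // intr_eq0; lia.
  rewrite exprMn -Ey rmorphM /= -exprM.
  have -> : ((k + h) * d * 2 = k * d + (k + h.*2) * d)%N by lia.
  by rewrite [in RHS]mulrACA -invfM -(exprD _ (k * d)) mulrAC mulVf ?mul1r.
by rewrite (leq_trans (gap2 _ _ _ le2 h0 Eb)) // leq_mul2r leq_maxr orbT.
Qed.

(* Points of [S] of absolute value above [C * T] that agree in sign, modulo
   [2 h0] and in block of length [T] coincide: distinct ones would differ by
   [2 h] with [h0 <= h < T], which forces an absolute value at most [C * h]. *)
Lemma count_gap (S : int -> bool) (h0 C T N : nat) (M : int) :
  (0 < T)%N ->
  (forall (n n' : int) (h : nat), S n -> S n' -> (0 <= n) = (0 <= n') ->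
     `|n'|%N = (`|n| + h.*2)%N -> (h0 <= h)%N -> (`|n| <= C * h)%N) ->
  (0 < h0)%N ->
  (#|[pred i : 'I_N | S (M + i.+1%:Z)%R]|
     <= 2 * ((C * T).+1 + (h0.*2).+1 * (N %/ T).+1))%N.
Proof.
move=> T0 gapS h00.
(* Pigeonhole: [phi] is shown injective on the counted indices, so the size of its target bounds
   their number. Small [|n|] are recorded outright. *)
pose phi (i : 'I_N) : bool * ('I_(C * T).+1 + 'I_(h0.*2).+1 * 'I_(N %/ T).+1) :=
  let n := M + i.+1%:Z in
  (0 <= n, if (`|n| <= C * T)%N then inl (inord `|n|)
           else inr (inord (`|n| %% h0.*2), inord (i %/ T))).
have -> : (2 * ((C * T).+1 + (h0.*2).+1 * (N %/ T).+1) =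
  #|{: bool * ('I_(C * T).+1 + 'I_(h0.*2).+1 * 'I_(N %/ T).+1)}|)%N.
  by rewrite card_prod card_bool card_sum card_prod !card_ord.
rewrite -(@card_in_imset _ _ phi) ?max_card //.
have key (i j : 'I_N) : (`|(M + i.+1%:Z)%R| <= `|(M + j.+1%:Z)%R|)%N ->
    S (M + i.+1%:Z) -> S (M + j.+1%:Z) -> phi i = phi j -> i = j.
  rewrite /phi; set n := M + i.+1%:Z; set n' := M + j.+1%:Z => le_nn' Sn Sn'.
  case=> sgn; have inj : `|n|%N = `|n'|%N -> i = j.
    by move=> E; apply: ord_inj; move: E sgn; rewrite /n /n'; clear; lia.
  case: leqP => le1; case: leqP => le2 //.
    by case=> /(congr1 val); rewrite /= !inordK ?ltnS.
  case=> /(congr1 val) + /(congr1 val) => /=.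
  have modlt k : (k %% h0.*2 < (h0.*2).+1)%N
    by rewrite ltnS ltnW ?ltn_mod ?double_gt0.
  have divlt (k : 'I_N) : (k %/ T < (N %/ T).+1)%N
    by rewrite ltnS leq_div2r // ltnW.
  rewrite !inordK // => Emod Ediv; apply: inj; apply/eqP/negPn/negP=> neq.
  have /dvdnP[q Eq] : (h0.*2 %| `|n'| - `|n|)%N by rewrite -eqn_mod_dvd // Emod.
  have Eh : `|n'|%N = (`|n| + (q * h0).*2)%N by rewrite doubleMr -Eq subnKC.
  have q0 : (0 < q)%N.
    case: q Eq Eh => // _ Eh.
    by case/negP: neq; rewrite Eh mul0n addn0.
  (* With [h = q h0], the gap principle gives [C T < |n| <= C h], so [T < h], against a distance
     [2h] smaller than the block length [T]. *)
  have := gapS _ _ _ Sn Sn' sgn Eh (leq_pmull _ q0).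
  move=> /(leq_trans le1); rewrite ltn_mul2l => /andP[_ ltT].
  have close : (`|n'| < `|n| + T)%N.
    have := ltn_pmod i T0; have := ltn_pmod j T0.
    have := divn_eq i T; have := divn_eq j T; rewrite Ediv.
    move: sgn; rewrite /n /n'; clear; lia.
  by move: close ltT; rewrite Eh; clear; lia.
move=> i j; rewrite !inE => Si Sj E.
have [le|/ltnW le] := leqP `|(M + i.+1%:Z)%R|%N `|(M + j.+1%:Z)%R|%N;
  first exact: key.
by apply/esym/key.
Qed.

(** * Choice of the block length and the final estimate *)

(** The block length [T], about [sqrt N], balances the [C T] small values against the [N / T]
    blocks. *)
Lemma sqrt_floor (N : nat) : (0 < N)%N ->
  exists T : nat, [/\ (0 < T)%N, (T ^ 2 <= N)%N & (N < T.+1 ^ 2)%N].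
Proof.
elim: N => // -[_ _|N /(_ isT)[T [T0 le1 le2]] _]; first by exists 1%N.
have [le|gt] := leqP (T.+1 ^ 2) N.+2; last by exists T; split=> //; lia.
by exists T.+1; split=> //; lia.
Qed.

Theorem theorem2 (R : realType) (g : int) (f : {poly int})
    (hg : 1 < g)
    (fdeg : (1 < size f)%N)
    (flead : 0 < lead_coef f)
    (fsep : no_multiple_roots f)
    (fnotmono : forall a : int, f <> a *: 'X) :
  exists c : R, 0 < c /\
    forall (M : int) (N : nat) (s : int),
      (1 <= N)%N -> squarefree_int s ->
      (Qcount f g M N s)%:R
        <= c * (N%:R `^ (500%:R / 679%:R)
                * ln (maxn N 2)%:R `^ (358%:R / 679%:R)).
Proof.
have [h0 [C [h00 gapu]]] := u_seq_gap hg fdeg fsep fnotmono.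
(* From [N / T <= T + 2] and [T >= 1] follow [C T + 1 <= (C + 1) T] and [N / T + 1 <= 4 T]. *)
pose D : nat := (2 * (C + 1 + (h0.*2).+1 * 4))%N.
(* The least value of the logarithmic factor, as [maxn N 2 >= 2]; dividing [D] by it makes up for
   [ln 2 < 1]. *)
pose l : R := ln 2%:R `^ (358%:R / 679%:R).
have l0 : 0 < l by apply: powR_gt0; apply: ln_gt0; rewrite ltr1n.
exists (D%:R / l); split;
  first by rewrite divr_gt0 // ltr0n /D muln_gt0 addn_gt0 addn1.
move=> M N s N1 _; have [T [T0 TN NT]] := sqrt_floor N1.
have leD : (Qcount f g M N s <= D * T)%N.
  pose S (n : int) := `[< Qsqrt (u_seq f g n) = Qsqrt s%:~R >].
  apply: (@leq_trans (2 * ((C * T).+1 + (h0.*2).+1 * (N %/ T).+1))).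
    apply: (@count_gap S) => // n n' h /asboolP Sn /asboolP Sn' sgn Eh leh.
    have [y Ey] : exists y, u_seq f g n * u_seq f g n' = y ^+ 2.
      by apply: Qsqrt_eq_mul_sqr; rewrite Sn.
    exact: gapu Ey.
  have : (N %/ T <= T + 2)%N by rewrite -ltnS ltn_divLR //; lia.
  by rewrite /D; move: (N %/ T)%N T0; clear; nia.
have leT : T%:R <= N%:R `^ (500%:R / 679%:R) :> R.
  apply: (@le_trans _ _ (N%:R `^ 2^-1)).
    rewrite powR12_sqrt // -[T%:R]ger0_norm // -sqrtr_sqr ler_wsqrtr //.
    by rewrite -natrX ler_nat.
  by apply: ler_powR; [rewrite ler1n | lra].
have lel : l <= ln (maxn N 2)%:R `^ (358%:R / 679%:R).
  have max1 : (1 <= maxn N 2)%N by rewrite leq_max orbT.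
  apply: ge0_ler_powR; first exact: divr_ge0 (ler0n _ _) (ler0n _ _).
  - by rewrite nnegrE ln_ge0 // ler1n.
  - by rewrite nnegrE ln_ge0 // ler1n.
  by rewrite ler_ln ?posrE ?ltr0n ?leq_max ?orbT // ler_nat leq_maxr.
apply: (@le_trans _ _ (D%:R * T%:R)); first by rewrite -natrM ler_nat.
rewrite -mulrA ler_wpM2l // mulrCA -[T%:R]mulr1 ler_pM //.
by rewrite mulrC ler_pdivlMr // mul1r.
Qed.
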